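(* Let $A$ be a finite (possibly empty) alphabet, $K$ a natural number and $l>0$ a natural number. If $F^A_{\omega,K}=C_0\cup\dots\cup C_{l-1}$ where each $C_m$ is Borel, then there exist $(r_0,c_0)\in F^A_{\omega,\omega}$ and $k<l$ such that $$[(r_0,c_0)]^A_K=\{(s,j)\cdot(r_0,c_0):(s,j)\in F^A_{\omega,K}\}\subseteq C_k.$$
   Context: Conventions: $\omega=\{0,1,2,\dots\}$, each natural number $K$ is identified with $\{0,\dots,K-1\}$. $A=\{\alpha_0<\dots<\alpha_{|A|-1}\}$ is a finite linearly ordered set of letters disjoint from $\omega$. For $L\le\omega$, $A\cup L$ is linearly ordered so that every element of $A$ precedes every element of $L$ (with $A$ and $L$ internally ordered as usual). For $K\le L\le\omega$, $F^A_{L,K}$ is the set of pairs $(r,c)$ with $r:A\cup L\to A\cup K$, $c:K\to L$, such that $r\upharpoonright A=\mathrm{id}_A$, $c$ is strictly increasing, and for all $x\in K$, $y\in L$: $r(c(x))=x$, and $y\le c(x)$ implies $r(y)\le x$. (If $A=\emptyset$ one writes $F_{L,K}$.) Composition: for $(s,j)\in F^A_{L,K}$, $(r,c)\in F^A_{M,L}$ ($K\le L\le M\le\omega$), $(s,j)\cdot(r,c)=(s\circ r,\,c\circ j)\in F^A_{M,K}$. For finite $K$, $F^A_{\omega,K}$ carries the subspace topology from the product $(A\cup K)^{A\cup\omega}\times\omega^K$ of discrete spaces; ''Borel'' refers to this topology. *)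

(* Defs.v *)
From mathcomp Require Import all_boot all_order.
From mathcomp Require Import all_classical.
From mathcomp Require Import topology measurable_structure.

Set Implicit Arguments.
Unset Strict Implicit.
Unset Printing Implicit Defensive.

Import Order.TTheory.

Local Open Scope order_scope.
Local Open Scope classical_set_scope.

(* The disjoint union A ∪ L is the sum type A + L, ordered so that every
   letter precedes every element of L. *)
Definition le_union d d' (A : porderType d) (L : porderType d')
    (u v : A + L) : bool :=
  match u, v with
  | inl a, inl b => a <= b
  | inl _, inr _ => true
  | inr _, inl _ => false
  | inr x, inr y => x <= y
  end.

(* The index sets L and K are totally ordered types. The ordinal omega is
   [nat], and the natural number K = {0, ..., K - 1} is ['I_K]. *)
Section Surjections.
Context {d dL dK : Order.disp_t}.
Variables (A : finOrderType d) (L : orderType dL) (K : orderType dK).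

(* (A ∪ K)^(A ∪ L) * L^K, a product of discrete spaces. *)
Definition ambient : topologicalType :=
  ({ptws (A + L)%type -> discrete_topology (A + K)%type}
   * {ptws K -> discrete_topology L})%type.

(* As a type, F A L K is the library's [set_type], so it carries the subspace
   topology inherited from [ambient]. *)
Definition F : set ambient :=
  [set rc | let r : A + L -> A + K := rc.1 in
            let c : K -> L := rc.2 in
    [/\ forall a : A, r (inl a) = inl a,
        {homo c : x y / x < y},
        forall x : K, r (inr (c x)) = inr x
      & forall (x : K) (y : L), y <= c x -> le_union (r (inr y)) (inr x)]].

End Surjections.

Arguments ambient {d dL dK} A L K.
Arguments F {d dL dK} A L K _.

Section Composition.
Context {d dM dL dK : Order.disp_t} {A : finOrderType d}.
Context {M : orderType dM} {L : orderType dL} {K : orderType dK}.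

Definition comp_pair (sj : ambient A L K) (rc : ambient A M L) :
    ambient A M K :=
  (sj.1 \o rc.1, rc.2 \o sj.2).

Lemma comp_pair_subproof (sj : F A L K) (rc : F A M L) :
  comp_pair (set_val sj) (set_val rc) \in F A M K.
Proof.
case: sj rc => [[s j] /= sjF] [[r c] /= rcF].
have [/= sA jlt sjK sle] := set_mem sjF.
have [/= rA clt rcK rle] := set_mem rcF.
apply/mem_set; split => /=.
- by move=> a; rewrite rA sA.
- by move=> x y xy; apply/clt/jlt.
- by move=> x; rewrite rcK sjK.
- move=> x y /rle; case: (r (inr y)) => [a _|z /= zj]; first by rewrite sA.
  exact: sle.
Qed.

(* (s, j) · (r, c) = (s ∘ r, c ∘ j). *)
Definition F_comp (sj : F A L K) (rc : F A M L) : F A M K :=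
  exist _ (comp_pair (set_val sj) (set_val rc)) (comp_pair_subproof sj rc).

End Composition.

Definition cone d (A : finOrderType d) (K : nat) (rc : F A nat nat) :
    set (F A nat 'I_K) :=
  [set F_comp sj rc | sj in [set: F A nat 'I_K]].

Arguments cone {d A} K rc _.

Definition Borel (T : topologicalType) : set_system T := <<s @open T >>.

(* Main.v *)
Require Import Defs.
From mathcomp Require Import all_boot all_order.
From mathcomp Require Import all_classical.
From mathcomp Require Import topology measurable_structure.
From mathcomp Require Import zify.

(* Write F^A_K for F^A_(omega, K). Up to and including the position c(0), an
   element (r, c) of F^A_(K+1) is a finite word w over A together with the new
   letter 0, followed by that letter; the rest is an element of F^(A + {0})_K.
   One inducts on K, for all alphabets at once. For K = 0 some colour class is
   comeager in a basic open set of A^omega, and a fusion gives a cone inside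
   any set that is comeager in a basic open set. For K + 1, the induction hypothesis
   over the alphabet A + {0} and a fusion make the colour of (r, c) depend only
   on w. The resulting colouring of words is made constant by a variant of
   Carlson's theorem on sequences of variable words, obtained from an idempotent
   ultrafilter q on words containing the variable such that substituting any
   letter in q gives an ultrafilter p with p q = q. *)

Set Implicit Arguments.
Unset Strict Implicit.
Unset Printing Implicit Defensive.

Local Open Scope classical_set_scope.

(** * Ultrafilters on free monoids *)

Section UltrafilterSemigroup.
Variable T : Type.
Implicit Types (E F G H U : set_system (seq T)) (X Y : set (seq T)).

(** Convolution, which extends concatenation to the Stone-Cech compactification of the free monoid.
    For an ultrafilter [G], the filter [conv E G] describes the right translate by [G] of the closed
    set of ultrafilters above [E]. *)
Definition conv F G : set_system (seq T) :=
  [set X | F [set s | G [set t | X (s ++ t)]]].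

Lemma convA F G H : conv (conv F G) H = conv F (conv G H).
Proof.
apply/funext => X; rewrite /conv /=; congr (F _); apply/funext => s /=.
congr (G _); apply/funext => t /=; congr (H _); apply/funext => u /=.
by rewrite catA.
Qed.

Lemma conv_filter F G : Filter F -> Filter G -> Filter (conv F G).
Proof.
move=> FF FG; split.
- by apply: (@filterE _ F) => s; apply: (@filterE _ G).
- by move=> X Y; apply: (@filterS2 _ F) => s; exact: (@filterI _ G).
- by move=> X Y XY; apply: (@filterS _ F) => s;
  apply: (@filterS _ G) => t; apply: XY.
Qed.

Lemma conv_proper F G :
  ProperFilter F -> ProperFilter G -> ProperFilter (conv F G).
Proof.
move=> FF FG; split; last by apply: conv_filter; exact: filter_filter.
by move=> /(@filter_ex _ F) [s] /(@filter_ex _ G) [t].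
Qed.

Lemma proper_setC F {FP : ProperFilter F} X : F X -> F (~` X) -> False.
Proof.
move=> FX FnX.
by have /filter_ex [? []] : F (X `&` ~` X) by exact: filterI.
Qed.

Lemma ultra_dichotomy F :
  ProperFilter F -> (forall X, F X \/ F (~` X)) -> UltraFilter F.
Proof.
move=> FF Fdich; split=> // G FG sFG; apply/seteqP; split=> // X GX.
by have [//|/sFG /(proper_setC GX)] := Fdich X.
Qed.

Lemma ultra_sub F G : UltraFilter F -> ProperFilter G -> F `<=` G -> F = G.
Proof. by move=> FU FG /max_filter ->. Qed.

Lemma ultra_setC F {FU : UltraFilter F} X : ~ F X -> F (~` X).
Proof. by case: (in_ultra_setVsetC X FU). Qed.

Lemma conv_ultra F G :
  UltraFilter F -> UltraFilter G -> UltraFilter (conv F G).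
Proof.
move=> FU GU.
have FGP := conv_proper (@ultra_proper _ _ FU) (@ultra_proper _ _ GU).
apply: ultra_dichotomy => X.
have [|nF] := in_ultra_setVsetC [set s | G [set t | X (s ++ t)]] FU.
  by left.
by right; apply: filterS nF => s; exact: (@ultra_setC G).
Qed.

Lemma conv_subl F F' G : F `<=` F' -> conv F G `<=` conv F' G.
Proof. by move=> FF' X /FF'. Qed.

Lemma filter_ultra F X : Filter F ->
  (forall U, UltraFilter U -> F `<=` U -> U X) -> F X.
Proof.
move=> FF FX; apply: contrapT => nFX.
(* The filter generated by [F] and the complement of [X], proper because [X] is not in [F]. *)
pose G := [set Y | F (X `|` Y)].
have GP : ProperFilter G.
  split; first by rewrite /G /= setU0.
  split; rewrite /G /=; first by rewrite setUT; exact: filterT.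
  - by move=> Y Z FY FZ; rewrite /= setUIr; exact: filterI.
  - by move=> Y Z YZ; apply: filterS; exact: setUS.
have [U [UU GU]] := ultraFilterLemma GP.
have : U X by apply: FX => // Y FY; apply: GU; apply: filterS FY => s; right.
have : U (~` X) by apply: GU; rewrite /G /= setUCr; exact: filterT.
by move=> UnX UX; exact: (proper_setC UX UnX).
Qed.

(* Identifying a filter with the closed set of ultrafilters above it, this is
   the closed set of all [H] above [E] with [conv H G = U]. *)
Definition solutions E G U : set_system (seq T) :=
  [set Z | exists2 X, U X & E [set s | G [set t | X (s ++ t)] -> Z s]].

Lemma solutions_proper E G U : ProperFilter E -> UltraFilter G ->
  ProperFilter U -> conv E G `<=` U -> ProperFilter (solutions E G U).
Proof.
move=> EP GU UP EGU; split.
  move=> [X UX EX]; have /EGU UnX : conv E G (~` X).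
    by apply: filterS EX => s; exact: ultra_setC.
  exact: (proper_setC UX UnX).
split.
- by exists setT; [exact: filterT|exact: filterE].
- move=> Y Z [X UX EX] [X' UX' EX']; exists (X `&` X'); first exact: filterI.
  apply: filterS2 EX EX' => s Ys Zs GX.
  by split; [apply: Ys|apply: Zs]; apply: filterS GX => t [].
- by move=> Y Z YZ [X UX EX]; exists X => //; apply: filterS EX => s Ys /Ys/YZ.
Qed.

Lemma sub_solutions E G U : Filter E -> Filter U -> E `<=` solutions E G U.
Proof.
move=> EF UF Z EZ; exists setT; first exact: filterT.
by apply: filterS EZ => s Zs _.
Qed.

Lemma solutions_conv E G U H : Filter E -> UltraFilter U -> UltraFilter G ->
  UltraFilter H -> solutions E G U `<=` H -> conv H G = U.
Proof.
move=> EF UU GU HU sH; have HGP := @ultra_proper _ _ (conv_ultra HU GU).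
apply/esym; apply: ultra_sub => X UX.
by apply: sH; exists X => //; apply: (@filterE _ E) => s.
Qed.

Lemma conv_solutions E G H : Filter H -> E `<=` H ->
  solutions E G (conv H G) `<=` H.
Proof.
move=> HF EH Z [X HX /EH EX].
by apply: (@filterS2 _ H) HX EX => s GX; apply.
Qed.

(** Right translation by [G] is continuous, so the closed set above [E] has a compact image, namely
    the closed set above [conv E G]. Concretely, any ultrafilter above [solutions E G U] serves as
    [H]. *)
Lemma conv_preimage E G U : ProperFilter E -> UltraFilter G -> UltraFilter U ->
  conv E G `<=` U ->
  exists H, [/\ UltraFilter H, E `<=` H & conv H G = U].
Proof.
move=> EP GU UU EGU.
have [H [HU sH]] := ultraFilterLemma (solutions_proper EP GU _ EGU).
exists H; split=> //; first by apply: subset_trans sH; apply: sub_solutions.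
exact: solutions_conv sH.
Qed.

(** Larger filters are smaller closed sets, so Zorn's lemma yields here a minimal nonempty closed
    set with property [P]. *)
Lemma maximal_filter (P : set_system (seq T) -> Prop) E :
  ProperFilter E -> P E ->
  (forall A : set (set_system (seq T)), A !=set0 ->
     A `<=` P -> P (\bigcup_(F in A) F)) ->
  exists F, [/\ ProperFilter F, P F, E `<=` F &
    forall F', ProperFilter F' -> P F' -> F `<=` F' -> F' = F].
Proof.
move=> EP PE PU.
pose Q := [set F | F = set0 \/ [/\ ProperFilter F, P F & E `<=` F]].
have [A AQ totA|F [QF Fmax]] := @Zorn_bigcup _ Q.
  pose B := A `&` [set F | F != set0].
  have AB : \bigcup_(F in A) F = \bigcup_(F in B) F.
    apply/seteqP; split=> X [F AF FX]; last by case: AF => AF _; exists F.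
    by exists F => //; split=> //; apply/set0P; exists X.
  have [B0|/set0P/negP/negPn/eqP B0] := pselect (B !=set0); last first.
    by left; rewrite AB B0 bigcup_set0.
  have BQ F : B F -> [/\ ProperFilter F, P F & E `<=` F].
    by move=> [/AQ [->|//]] /=; rewrite eqxx.
  right; rewrite AB; split; last first.
  - by have [F BF] := B0; have [_ _ EF] := BQ _ BF => X /EF FX; exists F.
  - by apply: PU => // F /BQ [].
  - apply: Build_ProperFilter_ex.
      by move=> X [F /BQ [FP _ _]]; exact: filter_ex.
    split.
    + have [F BF] := B0; have [FP _ _] := BQ _ BF.
      by exists F => //; exact: filterT.
    + move=> X Y [F BF FX] [G BG GY].
      have [FP _ _] := BQ _ BF; have [GP _ _] := BQ _ BG.
      have [FG|GF] := totA _ _ BF.1 BG.1.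
        by exists G => //; apply: filterI => //; exact: FG.
      by exists F => //; apply: filterI => //; exact: GF.
    + move=> X Y XY [F BF FX]; exists F => //; have [FP _ _] := BQ _ BF.
      exact: filterS FX.
have E0 : E !=set0 by exists setT; exact: filterT.
case: QF => [F0|[FP PF EF]].
  exfalso; apply: (Fmax E); last by right; split.
  by rewrite F0; split=> [|E00]; [exact: sub0set|have [X /E00] := E0].
exists F; split=> // F' FP' PF' FF'; apply: contrapT => neq.
apply: (Fmax F'); last by right; split=> //; exact: subset_trans FF'.
by split=> // F'F; apply: neq; apply/seteqP.
Qed.

Definition semigroup_filter E := forall F G, UltraFilter F -> UltraFilter G ->
  E `<=` F -> E `<=` G -> E `<=` conv F G.

(* Ellis' lemma. *)
Lemma idempotent_ultra E : ProperFilter E -> semigroup_filter E ->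
  exists U, [/\ UltraFilter U, E `<=` U & conv U U = U].
Proof.
move=> EP /(maximal_filter EP) [|F [FP Fsg EF Fmax]].
  move=> A [F0 AF0] Asg F G FU GU AF AG X [F1 AF1 F1X].
  by apply: (Asg F1) F1X => // Y FY; [apply: AF|apply: AG]; exists F1.
have [U [UU FU]] := ultraFilterLemma FP.
(* The translate by [U] of the minimal closed semigroup is a closed subsemigroup of it, hence all of
   it. *)
have FUF : conv F U = F.
  apply: Fmax.
  - exact: conv_proper.
  - move=> G H GU HU FUG FUH.
    have [G' [G'U FG' defG]] := conv_preimage FP UU GU FUG.
    have [H' [H'U FH' defH]] := conv_preimage FP UU HU FUH.
    rewrite -defG -defH -convA; apply: conv_subl.
    exact: (Fsg _ _ (conv_ultra G'U UU) H'U (Fsg _ _ G'U UU FG' FU) FH').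
  - move=> X FX; apply: (@filter_ultra F) => G GU FG.
    exact: (Fsg _ _ GU UU FG FU X FX).
have UP : ProperFilter U := @ultra_proper _ _ UU.
have sFU : conv F U `<=` U by rewrite FUF.
have sol_sub G : UltraFilter G -> solutions F U U `<=` G ->
    F `<=` G /\ conv G U = U.
  move=> GU sG; split; last exact: solutions_conv sG.
  by apply: subset_trans sG; apply: sub_solutions.
(* By [FUF] the equation [conv G U = U] is solvable in the semigroup; its solutions form a closed
   subsemigroup, which is everything by minimality, so [U] itself is a solution. *)
have solF : solutions F U U = F.
  apply: Fmax; [exact: solutions_proper| |by apply: sub_solutions].
  move=> G H GU HU /(sol_sub _ GU) [FG GUU] /(sol_sub _ HU) [FH HUU].
  have GHU := @ultra_proper _ _ (conv_ultra GU HU).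
  have := @conv_solutions F U _ (@filter_filter _ _ GHU) (Fsg _ _ GU HU FG FH).
  by rewrite convA HUU GUU.
exists U; split=> //; first exact: subset_trans FU.
by apply: (sol_sub U UU _).2; rewrite solF.
Qed.

End UltrafilterSemigroup.

(** * Sequences of variable words *)

Definition word (b : nat) : set (seq nat) := [set s | all (fun u => u < b)%N s].

Lemma word_cat b s t : word b (s ++ t) <-> word b s /\ word b t.
Proof. by rewrite /word /= all_cat; split => [/andP[]|[-> ->]]. Qed.

Definition inst (a x : nat) : seq nat -> seq nat :=
  map (fun u => if u == a then x else u).

Lemma inst_cat a x s t : inst a x (s ++ t) = inst a x s ++ inst a x t.
Proof. exact: map_cat. Qed.

Lemma inst_id a s : inst a a s = s.
Proof. by elim: s => //= u s ->; case: eqP => [->|]. Qed.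

Lemma inst_word_id a x s : word a s -> inst a x s = s.
Proof.
move=> ws; rewrite -[RHS]map_id; apply/eq_in_map => u /(allP ws) ua.
by rewrite ltn_eqF.
Qed.

Lemma inst_word a b x s : (x < b)%N -> word a.+1 s -> (a <= b)%N ->
  word b (inst a x s).
Proof.
move=> xb ws ab; rewrite /word /= all_map; apply/allP => u /(allP ws) /=.
by rewrite ltnS leq_eqVlt; case: eqP => //= _ /leq_trans -> .
Qed.

Definition variable_word (a : nat) : set (seq nat) :=
  [set s | word a.+1 s /\ a \in s].

Definition image_inst (a x : nat) (F : set_system (seq nat)) :
  set_system (seq nat) := [set X | F [set s | X (inst a x s)]].

Lemma image_inst_ultra a x F : UltraFilter F -> UltraFilter (image_inst a x F).
Proof.
move=> FU; have FP : ProperFilter (image_inst a x F).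
  split; first exact: (@filter_not_empty _ F).
  split.
  - exact: (@filterT _ F).
  - by move=> X Y; apply: (@filterI _ F).
  - by move=> X Y XY; apply: (@filterS _ F) => s; apply: XY.
apply: ultra_dichotomy => X; exact: in_ultra_setVsetC FU.
Qed.

Lemma image_inst_conv a x F G :
  image_inst a x (conv F G) = conv (image_inst a x F) (image_inst a x G).
Proof.
apply/funext => X; rewrite /image_inst /conv /=.
congr (F _); apply/funext => s /=; congr (G _); apply/funext => t /=.
by rewrite inst_cat.
Qed.

Lemma image_inst_id a x F : UltraFilter F -> F (word a) -> image_inst a x F = F.
Proof.
move=> FU Fw; apply/esym.
have iP := @ultra_proper _ _ (image_inst_ultra a x FU).
apply: ultra_sub => //.
move=> X FX; apply: (@filterS2 _ F) Fw FX => s ws.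
by rewrite /= inst_word_id.
Qed.

Lemma globally_proper (T : Type) (A : set T) :
  A !=set0 -> ProperFilter (globally A).
Proof. by move=> [x Ax]; exact: globally_properfilter Ax. Qed.

Lemma conv_word b F G : UltraFilter F -> UltraFilter G ->
  F (word b) -> G (word b) -> conv F G (word b).
Proof.
move=> FU GU Fw Gw; apply: (@filterS _ F) Fw => s ws.
by apply: (@filterS _ G) Gw => t wt; apply/word_cat.
Qed.

(** [p] is an idempotent in a minimal closed left ideal of the ultrafilters on words over [b]. An
    idempotent [e = conv u p] lies in that ideal, which by minimality consists of the left multiples
    of [e]; writing [p] as [conv y e] gives [conv p e = p]. *)
Lemma minimal_idempotent b : exists p, [/\ UltraFilter p, p (word b),
  conv p p = p & forall u, UltraFilter u -> u (word b) ->
    conv (conv u p) (conv u p) = conv u p -> conv p (conv u p) = p].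
Proof.
pose ideal E := forall F G, UltraFilter F -> UltraFilter G ->
  F (word b) -> E `<=` G -> E `<=` conv F G.
have EP : ProperFilter (globally (word b)).
  by apply: globally_proper; exists [::].
have Eideal : ideal (globally (word b)).
  move=> F G FU GU Fw EG X wX.
  have FGF := @filter_filter _ _ (@ultra_proper _ _ (conv_ultra FU GU)).
  have : conv F G (word b) by apply: conv_word => //; exact: EG.
  exact: (@filterS _ (conv F G)).
have [A A0 Aid|E [{}EP {}Eideal wE Emax]] := maximal_filter EP Eideal.
  move=> F G FU GU Fw AG X [H AH HX].
  by apply: (Aid H AH F G) HX => // Y HY; apply: AG; exists H.
have Esg : semigroup_filter E.
  move=> F G FU GU EF EG; apply: Eideal => //.
  by apply/EF/wE.
have [p [pU Ep pp]] := idempotent_ultra EP Esg.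
have pw : p (word b) by apply/Ep/wE.
exists p; split=> // u uU uw; set e := conv u p => ee.
have eU : UltraFilter e by exact: conv_ultra.
have Ee : E `<=` e by exact: Eideal.
have gP : ProperFilter (globally (word b)).
  by apply: globally_proper; exists [::].
have gF := @filter_filter _ _ gP.
have eP := @ultra_proper _ _ eU.
have NE : conv (globally (word b)) e = E.
  apply: Emax; first exact: conv_proper.
    move=> F G FU GU Fw NG.
    have [H [HU wH <-]] := conv_preimage gP eU GU NG.
    rewrite -convA; apply: conv_subl => X wX.
    have FHF := @filter_filter _ _ (@ultra_proper _ _ (conv_ultra FU HU)).
    have : conv F H (word b) by apply: conv_word => //; exact: wH.
    exact: (@filterS _ (conv F H)).
  move=> X EX s ws.
  have := @Eideal _ _ (principal_filter_ultra s) eU _ Ee X EX.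
  by rewrite /conv /= !principal_filterP; apply.
have Np : conv (globally (word b)) e `<=` p by rewrite NE.
have [y [yU _ <-]] := conv_preimage gP eU pU Np.
by rewrite convA ee.
Qed.

(** Take an idempotent [q1 = conv u p] with [u] on variable words, and [q = conv p q1]. Substituting
    [x < a] in [q1] gives an idempotent that is still a left multiple of [p], so by minimality the
    same substitution in [q] gives [p], and [conv p q = q]. For [x = a] the substitution is the
    identity. *)
Lemma variable_idempotent a : exists q, [/\ UltraFilter q,
  q (variable_word a), conv q q = q &
  forall x, (x <= a)%N -> conv (image_inst a x q) q = q].
Proof.
have [p [pU pw pp pmin]] := minimal_idempotent a.
have pP := @ultra_proper _ _ pU.
have pF := @filter_filter _ _ pP.
have gP : ProperFilter (globally (variable_word a)).
  apply: globally_proper; exists [:: a]; split; last exact: mem_head.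
  by rewrite /word /= ltnSn.
have gF := @filter_filter _ _ gP.
have word_S s : word a s -> word a.+1 s.
  by apply: sub_all => u; exact: leqW.
have Msg : semigroup_filter (conv (globally (variable_word a)) p).
  move=> F G FU GU MF MG.
  have [u [uU uV <-]] := conv_preimage gP pU FU MF.
  have [v [vU vV <-]] := conv_preimage gP pU GU MG.
  rewrite -convA; apply: conv_subl => X VX; rewrite convA.
  have {}uV : u (variable_word a) by exact: uV.
  have {}vV : v (variable_word a) by exact: vV.
  apply: (@filterS _ u) uV => s [ws sa]; apply: (@filterS _ p) (pw) => t wt.
  apply: (@filterS _ v) vV => r [wr _]; apply: VX; split; last first.
    by rewrite mem_cat sa.
  by apply/word_cat; split=> //; apply/word_cat; split=> //; exact: word_S.
have [q1 [q1U Mq1 q1q1]] := idempotent_ultra (@conv_proper _ _ _ gP pP) Msg.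
have [u [uU uV defq1]] := conv_preimage gP pU q1U Mq1.
have {}uV : u (variable_word a) by exact: uV.
have q1p : conv q1 p = q1 by rewrite -defq1 convA pp.
pose q := conv p q1.
have pq : conv p q = q by rewrite /q -convA pp.
have qq : conv q q = q by rewrite /q convA -(convA q1) q1p q1q1.
exists q; split=> //.
- exact: conv_ultra.
- apply: (@filterS _ p) (pw) => s ws; rewrite -defq1.
  apply: (@filterS _ u) uV => t [wt ta]; apply: (@filterS _ p) (pw) => r wr.
  split; last by rewrite !mem_cat ta orbT.
  by do 2 (apply/word_cat; split; rewrite //=; try exact: word_S).
move=> x; rewrite leq_eqVlt => /orP[/eqP -> |xa].
  rewrite -[RHS]qq; congr (conv _ q); apply/funext => X; rewrite /image_inst /=.
  by congr (q _); apply/funext => s /=; rewrite inst_id.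
suff -> : image_inst a x q = p by [].
rewrite image_inst_conv image_inst_id // -defq1 image_inst_conv.
rewrite (image_inst_id _ pU pw); apply: pmin.
- exact: (image_inst_ultra a x uU).
- by apply: (@filterS _ u) uV => s [ws _]; exact: inst_word.
rewrite -(image_inst_id x pU pw) -image_inst_conv defq1 -image_inst_conv.
by rewrite q1q1.
Qed.

Lemma filter_forall_in (T : Type) (I : eqType) (F : set_system T) (r : seq I)
    (P : I -> set T) : Filter F ->
  (forall i, i \in r -> F (P i)) -> F [set t | forall i, i \in r -> P i t].
Proof.
move=> FF; elim: r => [|i r IH] FP; first exact: (@filterE _ F).
have Fi := FP i (mem_head i r).
have /IH Fr j : j \in r -> F (P j) by move=> jr; apply: FP; rewrite inE jr orbT.
apply: (@filterS2 _ F) Fi Fr => t Pi Pr j; rewrite inE => /orP[/eqP -> //|].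
exact: Pr.
Qed.

Lemma ultra_pigeonhole (T : Type) (q : set_system T) (l : nat) (f : T -> nat) :
  UltraFilter q -> q [set t | (f t < l)%N] ->
  exists2 k, (k < l)%N & q [set t | f t = k].
Proof.
move=> qU; elim: l => [|l IH] ql.
  by have /(@filter_ex _ q) [] := ql.
have [qe|qn] := in_ultra_setVsetC [set t | f t = l] qU; first by exists l.
have [|k kl qk] := IH; last by exists k => //; exact: leqW.
by apply: (@filterS2 _ q) ql qn => t /=; lia.
Qed.

(** A prefix [Y] is kept when [Y ++ t] has colour [k] for [q]-most [t]. Since [q] absorbs its
    substitution instances on the left, [q]-most [W] keep every [Y ++ inst a x W], and only finitely
    many prefixes arise at each stage. *)
Lemma homogeneous_variable_words a l (f : seq nat -> nat) :
  (forall s, word a.+1 s -> (f s < l)%N) ->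
  exists W : nat -> seq nat, exists2 k, (k < l)%N &
    (forall n, variable_word a (W n)) /\
    forall x : nat -> nat, (forall i, (x i <= a)%N) -> forall n,
      f (flatten [seq inst a (x i) (W i) | i <- iota 0 n] ++ W n) = k.
Proof.
move=> fl; have [q [qU qV qq qx]] := variable_idempotent a.
have qF := @filter_filter _ _ (@ultra_proper _ _ qU).
have [|k kl qk] := @ultra_pigeonhole _ q l f qU.
  by apply: (@filterS _ q) (qV) => s [ws _]; exact: fl.
pose ok Y := q [set t | f (Y ++ t) = k].
have step (Ys : seq (seq nat)) : exists W, (forall Y, Y \in Ys -> ok Y) ->
    variable_word a W /\ forall Y, Y \in Ys -> f (Y ++ W) = k /\
      forall x, (x <= a)%N -> ok (Y ++ inst a x W).
  have [okY|nok] := pselect (forall Y, Y \in Ys -> ok Y); last by exists [::].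
  have qY : q [set W | forall Y, Y \in Ys -> f (Y ++ W) = k /\
      forall x, x \in iota 0 a.+1 -> ok (Y ++ inst a x W)].
    apply: filter_forall_in => Y /okY okYY.
    apply: (@filterI _ q); first exact: okYY.
    apply: filter_forall_in => x; rewrite mem_iota => /qx xq.
    move: okYY; rewrite /ok -{1}xq; apply: (@filterS _ q) => s /=.
    by apply: (@filterS _ q) => t; rewrite /= catA.
  have : q (variable_word a `&` [set W | forall Y, Y \in Ys -> f (Y ++ W) = k /\
      forall x, x \in iota 0 a.+1 -> ok (Y ++ inst a x W)]) by exact: filterI.
  move=> /(@filter_ex _ q) [W [VW YW]]; exists W => _; split=> // Y /YW [fY fx].
  by split=> // x xa; apply: fx; rewrite mem_iota.
have [w wP] := choice step.
(* [Z n] collects the fillings of the first [n] blocks by all values [x <= a]; [w] picks the next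
   block for all of them at once. *)
pose next Ys := [seq Y ++ inst a x (w Ys) | Y <- Ys, x <- iota 0 a.+1].
pose Z n := iter n next [:: [::]].
have Zok n Y : Y \in Z n -> ok Y.
  elim: n Y => [|n IH] Y; first by rewrite inE => /eqP ->.
  move=> /allpairsP [[Y' x] [Y'Z xa ->]].
  have {}xa : (x <= a)%N by move: xa; rewrite mem_iota.
  by have [_ /(_ _ Y'Z) [_]] := wP _ IH; apply.
exists (w \o Z), k => //; split=> [n|x xa n]; first by have [] := wP _ (Zok n).
suff Zn : flatten [seq inst a (x i) ((w \o Z) i) | i <- iota 0 n] \in Z n.
  by have [_ /(_ _ Zn) []] := wP _ (Zok n).
elim: n => [|n IH]; first by rewrite mem_head.
rewrite -addn1 iotaD map_cat flatten_cat add0n.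
rewrite [flatten (map _ [:: n])]cats0 addn1.
apply/allpairsP.
exists (flatten [seq inst a (x i) ((w \o Z) i) | i <- iota 0 n], x n).
by split=> //; rewrite mem_iota /= ltnS.
Qed.

(** * Rigid surjections *)

(* Values are coded by natural numbers: in the presence of [a] letters, the
   letters are [0, ..., a - 1] and the element [x] of [K] is [a + x]. Adjoining
   the least element of [K] to the alphabet then amounts to replacing [a] by
   [a + 1]. The pairs of F_(omega, omega) are of type [surj]; those of
   F_(omega, K) are of type [point], with the values of [c] listed. The
   monotonicity of [c] follows from the conditions of [rigid] and [inF]. *)

Definition subst (a : nat) (s : nat -> nat) (v : nat) : nat :=
  if (v < a)%N then v else s (v - a)%N.

Definition surj : Type := (nat -> nat) * (nat -> nat).

Definition rigid (a : nat) (R : surj) := forall x,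
  R.1 (R.2 x) = (a + x)%N /\ forall y, (y <= R.2 x)%N -> (R.1 y <= a + x)%N.

Definition scomp (a : nat) (S R : surj) : surj :=
  (subst a S.1 \o R.1, R.2 \o S.2).

Definition point : Type := (nat -> nat) * seq nat.

Definition inF (a K : nat) (e : point) :=
  [/\ size e.2 = K, forall y, (e.1 y < a + K)%N & forall x, (x < K)%N ->
    e.1 (nth 0 e.2 x) = (a + x)%N /\
    forall y, (y <= nth 0 e.2 x)%N -> (e.1 y <= a + x)%N].

Definition act (a : nat) (e : point) (R : surj) : point :=
  (subst a e.1 \o R.1, map R.2 e.2).

Lemma subst_ge a s v : subst a s (a + v) = s v.
Proof. by rewrite /subst ltnNge leq_addr /= addKn. Qed.

Lemma subst_comp a s t v : subst a (subst a s \o t) v = subst a s (subst a t v).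
Proof. by rewrite /subst /=; case: ltnP => // va; rewrite va. Qed.

Definition sid (a : nat) : surj := (addn a, id).

Lemma rigid_sid a : rigid a (sid a).
Proof. by move=> x; split=> //= y; rewrite leq_add2l. Qed.

Lemma scompA a P Q R : scomp a (scomp a P Q) R = scomp a P (scomp a Q R).
Proof.
by congr pair; apply/funext => y; rewrite /= subst_comp.
Qed.

Lemma act_scomp a e Q R : act a e (scomp a Q R) = act a (act a e Q) R.
Proof.
congr pair; last by rewrite /= -map_comp.
by apply/funext => y; rewrite /= subst_comp.
Qed.

Lemma scomp_sid a R : scomp a (sid a) R = R.
Proof.
case: R => r c; congr pair; apply/funext => y; rewrite /= /subst.
by case: ltnP => // /subnKC.
Qed.

Lemma rigid_scomp a S R : rigid a S -> rigid a R -> rigid a (scomp a S R).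
Proof.
move=> Sr Rr x /=; have [RS RSle] := Rr (S.2 x); have [Sx Sle] := Sr x.
split=> [|y /RSle]; first by rewrite RS subst_ge.
rewrite /subst; case: ltnP => [ya _|ya yS]; first by lia.
by apply: Sle; lia.
Qed.

Lemma inF_act a K e R : inF a K e -> rigid a R -> inF a K (act a e R).
Proof.
move=> [se eb ec] Rr; split=> [|y|x xK] /=; first by rewrite size_map.
  by rewrite /subst; case: (ltnP (R.1 y) a) => [|_]; [lia|exact: eb].
rewrite (nth_map 0) ?se //.
have [Rx Rle] := Rr (nth 0 e.2 x); have [ex ele] := ec x xK.
split=> [|y /Rle]; first by rewrite Rx subst_ge.
rewrite /subst; case: ltnP => [ya _|ya yS]; first by lia.
by apply: ele; lia.
Qed.

Lemma rigid_mono a R x y : rigid a R -> (x < y)%N -> (R.2 x < R.2 y)%N.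
Proof.
move=> Rr xy; rewrite ltnNge; apply/negP => /(Rr x).2.
by rewrite (Rr y).1; lia.
Qed.

Lemma rigid_ge a R x : rigid a R -> (x <= R.2 x)%N.
Proof.
move=> Rr; elim: x => // x IH; apply: leq_ltn_trans IH _.
exact: rigid_mono Rr _.
Qed.

Definition fixes (a n : nat) (Q : surj) :=
  forall i, (i <= n)%N -> Q.1 i = (a + i)%N /\ Q.2 i = i.

Lemma fixes_scomp a n P Q :
  fixes a n P -> fixes a n Q -> fixes a n (scomp a P Q).
Proof.
move=> Pn Qn i i_n; have [Q1 Q2] := Qn i i_n; have [P1 P2] := Pn i i_n.
by rewrite /= Q1 P2 Q2 subst_ge P1.
Qed.

(** * Infinite products of rigid surjections and fusion *)

Section Fusion.
Variables (a : nat) (q : nat -> surj).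
Hypothesis q_rigid : forall n, rigid a (q n).
Hypothesis q_fixes : forall n, fixes a n (q n).

Fixpoint sprod (n m : nat) : surj :=
  if m is m'.+1 then scomp a (q (n + m')) (sprod n m') else sid a.

Definition slimit (n : nat) : surj :=
  (fun y => (sprod n y).1 y, fun x => (sprod n x).2 x).

Lemma rigid_sprod n m : rigid a (sprod n m).
Proof. by elim: m => [|m IH]; [exact: rigid_sid|exact: rigid_scomp]. Qed.

Lemma fixes_sprod n m : fixes a n (sprod n m).
Proof.
elim: m => [|m IH] //; apply: fixes_scomp IH => i i_n.
by apply: q_fixes; lia.
Qed.

(** A rigid surjection has value at most [a + y] at [y], and the factor of index [n + (d + y)] fixes
    everything up to [y], so the factors after the first [y] change nothing at [y]. *)
Lemma sprod_limit n m y : (y <= m)%N ->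
  (sprod n m).1 y = (slimit n).1 y /\ (sprod n m).2 y = (slimit n).2 y.
Proof.
move=> /subnK <-; elim: (m - y)%N => [|d [IH1 IH2]]; first by [].
rewrite addSn /= IH1.
have Pr := rigid_sprod n (d + y).
have [q1 q2] : _ /\ _ := @q_fixes (n + (d + y)) y ltac:(lia).
split; last by rewrite q2 IH2.
have : ((slimit n).1 y <= a + y)%N.
  by rewrite -IH1; apply: (Pr y).2; exact: rigid_ge Pr.
rewrite /subst; case: ltnP => // ay ya.
by rewrite (q_fixes _).1 ?subnKC //; lia.
Qed.

Lemma rigid_slimit n : rigid a (slimit n).
Proof.
move=> x; pose m := maxn x ((slimit n).2 x).
have xm : (x <= m)%N by rewrite leq_maxl.
have [Px Ple] := rigid_sprod n m x.
rewrite (sprod_limit n xm).2 in Px Ple.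
rewrite (sprod_limit n (leq_maxr _ _)).1 in Px; split=> // y yx.
by rewrite -(sprod_limit n (leq_trans yx (leq_maxr x _))).1 Ple.
Qed.

Lemma fixes_slimit n : fixes a n (slimit n).
Proof. by move=> i i_n; exact: fixes_sprod. Qed.

Lemma sprod_add k n m : sprod k (n + m) = scomp a (sprod (k + n) m) (sprod k n).
Proof.
elim: m => [|m IH]; first by rewrite addn0 scomp_sid.
by rewrite addnS /= IH scompA addnA.
Qed.

Lemma slimit_sprod n : slimit 0 = scomp a (slimit n) (sprod 0 n).
Proof.
congr pair; apply/funext => y.
  pose v := (sprod 0 n).1 y; pose m := maxn y v.
  have ynm : (y <= n + m)%N by lia.
  rewrite -[LHS]/((slimit 0).1 y) -(sprod_limit 0 ynm).1 sprod_add /=.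
  rewrite -/v /subst; case: ltnP => // av.
  have vm : (v - a <= m)%N by lia.
  by rewrite add0n (sprod_limit n vm).1.
rewrite -[LHS]/((slimit 0).2 y) -(sprod_limit 0 (leq_addl n y)).2 sprod_add /=.
by rewrite add0n (sprod_limit n (leqnn y)).2.
Qed.

End Fusion.

(** [I] is an invariant of the construction and [Phi n] is the task of stage [n]. The limit is the
    surjection obtained after stage [n] composed with a tail that fixes everything up to [n], so
    each completed task survives. *)
Lemma fusion a (I Phi : nat -> surj -> Prop) (R0 : surj) :
  rigid a R0 -> I 0 R0 ->
  (forall n R, rigid a R -> I n R -> exists Q, [/\ rigid a Q, fixes a n Q,
     I n.+1 (scomp a Q R) & Phi n (scomp a Q R)]) ->
  (forall n R Q, rigid a R -> rigid a Q -> fixes a n Q -> Phi n R ->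
     Phi n (scomp a Q R)) ->
  exists R, rigid a R /\ forall n, Phi n R.
Proof.
move=> R0r I0 step her.
have step' (nR : nat * surj) : exists Q, rigid a Q /\ fixes a nR.1 Q /\
    (rigid a nR.2 -> I nR.1 nR.2 ->
     I nR.1.+1 (scomp a Q nR.2) /\ Phi nR.1 (scomp a Q nR.2)).
  case: nR => n R /=; have [[Rr IR]|nIR] := pselect (rigid a R /\ I n R).
    by have [Q [Qr Qf IQ PQ]] := step n R Rr IR; exists Q.
  exists (sid a); split; first exact: rigid_sid.
  by split=> // Rr IR; case: nIR.
have [qq qqP] := choice step'.
pose Rn := fix Rn n := if n is m.+1 then scomp a (qq (m, Rn m)) (Rn m) else R0.
pose q n := qq (n, Rn n).
have qr n : rigid a (q n) by have [] := qqP (n, Rn n).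
have qf n : fixes a n (q n) by have [_ [qf _]] := qqP (n, Rn n).
have RI n : rigid a (Rn n) /\ I n (Rn n).
  elim: n => // n [Rr IR]; split; first exact: (rigid_scomp (qr n) Rr).
  by have [_ [_ /(_ Rr IR) []]] := qqP (n, Rn n).
have RnE n : Rn n = scomp a (sprod a q 0 n) R0.
  elim: n => [|n IH]; first by rewrite scomp_sid.
  by rewrite /= -/(q n) IH scompA.
exists (scomp a (slimit a q 0) R0); split.
  by apply: rigid_scomp => //; apply: rigid_slimit.
move=> n; rewrite (slimit_sprod qr qf n.+1) scompA -RnE.
have [Rr IR] := RI n; have [_ [_ /(_ Rr IR) [_ Phin]]] := qqP (n, Rn n).
apply: her => //; first by have [] := RI n.+1.
  exact: rigid_slimit.
by move=> i i_n; apply: (fixes_slimit qf); exact: leqW.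
Qed.

(* What precedes the last occurrence of [a]. *)
Definition trim (a : nat) (s : seq nat) : seq nat :=
  take (size s - (index a (rev s)).+1) s.

Lemma size_trim a s : a \in s -> (size (trim a s) < size s)%N.
Proof.
case: s => // u s _; rewrite /trim size_takel ?leq_subr //=; lia.
Qed.

Lemma nth_size_trim a s : a \in s -> nth 0 s (size (trim a s)) = a.
Proof.
move=> sa; rewrite /trim size_takel ?leq_subr //.
have ra : a \in rev s by rewrite mem_rev.
have lt : (index a (rev s) < size s)%N by rewrite -size_rev index_mem.
by rewrite -nth_rev // nth_index.
Qed.

(** Cutting at the last occurrence, not the first, is insensitive to a prefix that may itself
    contain [a]. *)
Lemma trim_cat a s t : a \in t -> trim a (s ++ t) = s ++ trim a t.
Proof.
move=> ta; have ra : a \in rev t by rewrite mem_rev.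
have lt : (index a (rev t) < size t)%N by rewrite -size_rev index_mem.
rewrite /trim rev_cat index_cat ra size_cat -addnBA // take_cat.
by rewrite ltnNge leq_addr /= addKn.
Qed.

Lemma word_trim a b s : word b s -> word b (trim a s).
Proof. by move=> ws; apply/allP => u /mem_take; exact: (allP ws). Qed.

(** The blocks [W i], with the variable of the [i]-th one renamed [a + i], are concatenated into
    [P.1], and [P.2 i] is the last position of that variable. The word coloured in the conclusion is
    what precedes [c(0)] in the product with [P] of a point that starts with [w] followed by the
    letter [a]. *)
Lemma word_pigeonhole a l (f : seq nat -> nat) :
  (forall s, word a.+1 s -> (f s < l)%N) ->
  exists P : surj, exists2 k, (k < l)%N & rigid a P /\
    forall w, word a.+1 w ->
      f (mkseq (subst a (nth a w) \o P.1) (P.2 (size w))) = k.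
Proof.
move=> fl.
have [s /(word_trim a)|W [k kl [VW fW]]] :=
  @homogeneous_variable_words a l (f \o trim a); first exact: fl.
(* Every block is nonempty, so [Z y.+1] is long enough to have a position [y]. *)
exists (let Z n := flatten [seq inst a (a + i) (W i) | i <- iota 0 n] in
  (fun y => nth 0 (Z y.+1) y,
   fun n => size (Z n) + size (trim a (W n))))%N, k => //.
pose Z n := flatten [seq inst a (a + i) (W i) | i <- iota 0 n].
have ZS n : Z n.+1 = Z n ++ inst a (a + n) (W n).
  rewrite /Z -[in iota 0 n.+1]addn1 iotaD map_cat flatten_cat add0n.
  by rewrite [flatten (map _ [:: n])]cats0.
have Wa n : a \in W n by have [] := VW n.
have sZ n : (n <= size (Z n))%N.
  elim: n => // n IH; rewrite ZS size_cat size_map.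
  by have := size_trim (Wa n); lia.
have Zprefix m n : (m <= n)%N -> exists t, Z n = Z m ++ t.
  move=> /subnK <-; elim: (n - m)%N => [|d [t IH]].
    by exists [::]; rewrite cats0.
  by exists (t ++ inst a (a + (d + m)) (W (d + m))); rewrite addSn ZS IH catA.
have nthZ n y : (y < size (Z n))%N -> nth 0 (Z y.+1) y = nth 0 (Z n) y.
  move=> yn; have := sZ y.+1.
  case: (leqP n y.+1) => [|/ltnW] /Zprefix [t ->] ys.
    by rewrite nth_cat yn.
  by rewrite nth_cat ys.
have wZ n : word (a + n) (Z n).
  elim: n => // n IH; rewrite ZS; apply/word_cat; split.
    by apply: sub_all IH => u; rewrite addnS; exact: leqW.
  by have [wW _] := VW n; apply: (inst_word _ wW); lia.
have lZ n : (size (Z n) + size (trim a (W n)) < size (Z n.+1))%N.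
  by rewrite ZS size_cat size_map ltn_add2l size_trim.
split=> [n|w ww] /=.
  rewrite -!/(Z _); split=> [|y yn].
    rewrite (nthZ n.+1) // ZS nth_cat ltnNge leq_addr /= addKn.
    by rewrite (nth_map 0) ?size_trim // nth_size_trim // eqxx.
  have yS : (y < size (Z n.+1))%N by exact: leq_ltn_trans yn (lZ n).
  rewrite -/(Z y.+1) (nthZ n.+1) // -ltnS -addnS.
  exact: (all_nthP 0 (wZ n.+1)).
(* The default [a] leaves block [size w] uninstantiated, as the homogeneity of [W] requires of the
   last block. *)
pose x i := nth a w i.
have xa i : (x i <= a)%N.
  rewrite /x; case: (ltnP i (size w)) => iw; last by rewrite nth_default.
  by rewrite -ltnS; exact: (all_nthP a ww).
rewrite -[RHS](fW x xa (size w)) /= trim_cat // -!/(Z _).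
congr f.
have substW i : map (subst a x) (inst a (a + i) (W i)) = inst a (x i) (W i).
  rewrite -map_comp; have [wW _] := VW i.
  apply/eq_in_map => u /(allP wW) /=; rewrite ltnS leq_eqVlt /subst.
  case: eqP => [-> _|_ /= ->] //.
  by rewrite ltnNge leq_addr /= addKn.
have substZ n : map (subst a x) (Z n) =
    flatten [seq inst a (x i) (W i) | i <- iota 0 n].
  rewrite /Z map_flatten -map_comp; congr flatten.
  by apply: eq_map => i /=; rewrite substW.
apply: (@eq_from_nth _ 0).
  by rewrite size_mkseq size_cat -substZ size_map.
rewrite size_mkseq => y yn; rewrite nth_mkseq //=.
have yS : (y < size (Z (size w).+1))%N by exact: ltn_trans yn (lZ _).
rewrite -/(Z y.+1) (nthZ (size w).+1) // -(nth_map 0 0 (subst a x)) //.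
have xw : x (size w) = a by rewrite /x nth_default.
rewrite ZS map_cat substZ substW xw inst_id !nth_cat.
rewrite -substZ size_map; case: ltnP => // Zy.
have : (y - size (Z (size w)) < size (trim a (W (size w))))%N.
  by rewrite ltn_subLR.
by rewrite /trim size_takel ?leq_subr // => yt; rewrite nth_take.
Qed.

(** * The Baire property *)

Definition bounded (b : nat) (x : nat -> nat) := forall i, (x i < b)%N.

Definition extends (x : nat -> nat) (u : seq nat) := mkseq x (size u) = u.

(* The points of a basic open set that follow a strategy form a dense G_delta
   set, and every dense G_delta set contains a set of this form. *)
Definition follows (x : nat -> nat) (T : seq nat -> seq nat) :=
  forall N, exists2 m, (N <= m)%N & extends x (mkseq x m ++ T (mkseq x m)).

Definition strategy (b : nat) (T : seq nat -> seq nat) :=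
  forall v, word b v -> word b (T v).

Definition residual (b : nat) (u : seq nat) (D : set (nat -> nat)) :=
  exists2 T, strategy b T &
    forall x, bounded b x -> extends x u -> follows x T -> D x.

(** The Baire property in the space of sequences over [b], in local form: every basic open set
    contains one in which [D] is comeager or meager. *)
Definition baire (b : nat) (D : set (nat -> nat)) :=
  forall u, word b u -> exists2 z, word b z &
    residual b (u ++ z) D \/ residual b (u ++ z) (~` D).

Lemma extendsP x u :
  extends x u <-> forall i, (i < size u)%N -> x i = nth 0 u i.
Proof.
split=> [xu i iu|xu]; first by rewrite -xu nth_mkseq.
apply: (@eq_from_nth _ 0); rewrite size_mkseq // => i iu.
by rewrite nth_mkseq // xu.
Qed.

Lemma extends_catl x u v : extends x (u ++ v) -> extends x u.
Proof.
move=> /extendsP xuv; apply/extendsP => i iu.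
by rewrite xuv ?size_cat ?nth_cat ?iu // ltn_addr.
Qed.

Lemma word_mkseq b x m : bounded b x -> word b (mkseq x m).
Proof. by move=> xb; apply/allP => u /mapP [i _ ->]; exact: xb. Qed.

Lemma extends_split x u m : extends x u -> (size u <= m)%N ->
  mkseq x m = u ++ drop (size u) (mkseq x m).
Proof.
move=> xu um; rewrite -[LHS](cat_take_drop (size u)); congr (_ ++ _).
by rewrite -[RHS]xu /mkseq -map_take take_iota (minn_idPl um).
Qed.

Lemma residual_sub b u D D' : D `<=` D' -> residual b u D -> residual b u D'.
Proof. by move=> DD' [T Ts TD]; exists T => // x xb xu xT; exact/DD'/TD. Qed.

Lemma merge_strategies b (I : countType) (F : I -> seq nat -> seq nat) :
  (forall i, strategy b (F i)) ->
  exists2 T, strategy b T & forall x, follows x T -> forall i, follows x (F i).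
Proof.
move=> Fs; pose G j := if unpickle j is Some i then F i else fun=> [::].
have Gs j : strategy b (G j).
  by rewrite /G; case: unpickle => [i|v _]; [exact: Fs|].
pose g := fix g k v :=
  if k is k'.+1 then g k' v ++ G k' (v ++ g k' v) else [::].
have gw k v : word b v -> word b (g k v).
  move=> vw; elim: k => // k IH; apply/word_cat; split=> //.
  by apply: Gs; apply/word_cat.
have gS j k v : (j < k)%N -> exists t, g k v = g j.+1 v ++ t.
  elim: k => // k IH; rewrite ltnS leq_eqVlt => /orP[/eqP ->|/IH [t gk]].
    by exists [::]; rewrite cats0.
  by exists (t ++ G k (v ++ g k v)); rewrite catA -gk.
(* The strategies answer in turn, the first [m + 1] of them at a position of length [m]; so strategy
   [i] takes part from length [pickle i] on. *)
exists (fun v => g (size v).+1 v) => [v vw|x xT i N]; first exact: gw.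
have [m mM xm] := xT (maxn N (pickle i)).
set v := mkseq x m in xm.
have [|t gt] := gS (pickle i) (size v).+1 v; first by rewrite size_mkseq; lia.
move: xm; rewrite gt /= /G pickleK -/(G _) !catA.
set s := v ++ g (pickle i) v => /extends_catl xs.
have xs' := extends_catl xs.
exists (size s); last by rewrite xs'.
by rewrite size_cat size_mkseq; lia.
Qed.

Lemma residual_bigcap b u (D : nat -> set (nat -> nat)) : word b u ->
  (forall n v, word b v ->
     exists2 z, word b z & residual b (u ++ v ++ z) (D n)) ->
  residual b u (\bigcap_n D n).
Proof.
move=> uw Dz.
have zzP (nv : nat * seq nat) : exists z, word b z /\
    (word b nv.2 -> residual b (u ++ nv.2 ++ z) (D nv.1)).
  have [vw|nvw] := pselect (word b nv.2); last by exists [::].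
  by have [z zw Rz] := Dz nv.1 _ vw; exists z.
have [zz {}zzP] := choice zzP.
have TTP (nv : nat * seq nat) : exists T, strategy b T /\
    (residual b nv.2 (D nv.1) -> forall x, bounded b x -> extends x nv.2 ->
       follows x T -> D nv.1 x).
  have [[T Ts TD]|nR] := pselect (residual b nv.2 (D nv.1)).
    by exists T.
  by exists (fun=> [::]).
have [TT {}TTP] := choice TTP.
(* [(n, None)] moves into a basic open set where [D n] is comeager; [(n, Some w)] plays for [D n]
   below [w]. A sequence that follows all of them enters some such [w] and wins there. *)
pose F (i : nat * option (seq nat)) v :=
  if i.2 is Some w then TT (i.1, w) v else zz (i.1, drop (size u) v).
have [|T Ts TF] := @merge_strategies b _ F.
  move=> [n [w|]] v vw; rewrite /F /=; first by have [/(_ _ vw)] := TTP (n, w).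
  by have [] := zzP (n, drop (size u) v).
exists T => // x xb xu /TF xF n _.
have [m um xm] := xF (n, None) (size u).
have wx := word_mkseq m xb.
have wd : word b (drop (size u) (mkseq x m)).
  by apply/allP => c /mem_drop; exact: (allP wx).
move: xm; rewrite {1}(extends_split xu um) /F /= -catA.
set w := u ++ _ => xw; have [_ /(_ _ x xb xw)] := TTP (n, w); apply.
  by have [_] := zzP (n, drop (size u) (mkseq x m)); exact.
exact: (xF (n, Some w)).
Qed.

Lemma baire_ext b D D' : (forall x, bounded b x -> D x <-> D' x) ->
  baire b D -> baire b D'.
Proof.
move=> DD' Db u /Db [z zw Dz]; exists z => //.
case: Dz => -[T Ts TD]; [left|right]; exists T => // x xb xu xT.
  exact/DD'/TD.
by move=> /(DD' x xb); exact: TD.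
Qed.

Lemma baireC b D : baire b D -> baire b (~` D).
Proof.
move=> Db u /Db [z zw [Dz|Dz]]; exists z => //; last by left.
by right; rewrite setCK.
Qed.

(** If no [D n] is comeager in a basic open set below [u], then each is meager in densely many of
    them, and the union is meager below [u]. *)
Lemma baire_bigcup b (D : nat -> set (nat -> nat)) :
  (forall n, baire b (D n)) -> baire b (\bigcup_n D n).
Proof.
move=> Db u uw.
have [[n [z zw Dz]]|nD] :=
    pselect (exists n, exists2 z, word b z & residual b (u ++ z) (D n)).
  by exists z => //; left; apply: residual_sub Dz; exact: bigcup_sup.
exists [::] => //; right; rewrite cats0 setC_bigcup.
apply: residual_bigcap => // n v vw.
have [|z zw [Dz|Dz]] := Db n (u ++ v); first exact/word_cat.
  exfalso; apply: nD; exists n, (v ++ z); first exact/word_cat.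
  by rewrite catA.
by exists z => //; rewrite catA.
Qed.

Lemma baire_open b (D : set (nat -> nat)) :
  (forall x, bounded b x -> D x -> exists m, forall x', bounded b x' ->
     (forall i, (i < m)%N -> x' i = x i) -> D x') -> baire b D.
Proof.
move=> Do u uw.
have [[x [xb xu Dx]]|nD] :=
    pselect (exists x, [/\ bounded b x, extends x u & D x]).
  have [m Dm] := Do x xb Dx.
  exists (drop (size u) (mkseq x (size u + m))).
    by apply/allP => c /mem_drop; exact: (allP (word_mkseq _ xb)).
  left; rewrite -extends_split ?leq_addr //; exists (fun=> [::]) => // x' x'b.
  move=> /extendsP; rewrite size_mkseq => x'x _; apply: Dm => // i im.
  by rewrite x'x ?nth_mkseq // ltn_addl.
exists [::] => //; right; rewrite cats0; exists (fun=> [::]) => // x xb xu _ Dx.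
by apply: nD; exists x.
Qed.

(** The identity with the constant letters [z] inserted just before the variable [n]. *)
Definition insert (b n : nat) (z : seq nat) : surj :=
  (fun i => if (i < n)%N then (b + i)%N
            else if (i < n + size z)%N then nth 0 z (i - n)
            else (b + (i - size z))%N,
   fun x => if (x < n)%N then x else (x + size z)%N).

Lemma rigid_insert b n z : word b z -> rigid b (insert b n z).
Proof.
move=> zw x; rewrite /insert /=; case: (ltnP x n) => xn.
  by rewrite xn; split=> // y yx; rewrite ifT; lia.
rewrite ifF; last by lia.
rewrite ifF; last by lia.
split=> [|y yx]; first by lia.
case: ltnP => yn; first by lia.
case: ltnP => yz; last by lia.
have /(all_nthP 0 zw) : (y - n < size z)%N by lia.
by lia.
Qed.

Lemma bounded_subst b x (R : surj) :
  bounded b x -> bounded b (subst b x \o R.1).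
Proof. by move=> xb i; rewrite /= /subst; case: (ltnP (R.1 i) b). Qed.

Fixpoint words (b p : nat) : seq (seq nat) :=
  if p is p'.+1 then [seq x :: w | x <- iota 0 b, w <- words b p']
  else [:: [::]].

Lemma mem_words b p w :
  (w \in words b p) = all (fun u => u < b)%N w && (size w == p).
Proof.
elim: p w => [|p IH] [|c w] //=.
  by rewrite andbF.
  by apply/negP => /allpairsP [] ? [].
apply/allpairsP/andP.
  move=> [[c' w'] /= [c'b w'b [-> ->]]].
  by move: c'b w'b; rewrite mem_iota IH eqSS add0n /= => -> /andP[-> ->].
move=> [/andP[cb wb] /eqP[ws]].
by exists (c, w); split; rewrite //= ?mem_iota // IH wb ws eqxx.
Qed.

(** The answers are appended for one [u] at a time; later additions go at the end and do not disturb
    earlier answers. *)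
Lemma strategy_words b T (L : seq (seq nat)) : strategy b T ->
  (forall u, u \in L -> word b u) ->
  exists2 z, word b z & forall u, u \in L ->
    exists z1 z2, z = z1 ++ T (u ++ z1) ++ z2.
Proof.
move=> Ts; elim: L => [|u L IH] Lw; first by exists [::].
have [v vL|z zw zL] := IH; first by apply: Lw; rewrite inE vL orbT.
exists (z ++ T (u ++ z)).
  apply/word_cat; split=> //; apply: Ts; apply/word_cat; split=> //.
  exact/Lw/mem_head.
move=> v; rewrite inE => /orP[/eqP ->|/zL [z1 [z2 ez]]].
  by exists z, [::]; rewrite cats0.
by exists z1, (z2 ++ T (u ++ z)); rewrite {1}ez !catA.
Qed.

(** Stage [n] of the fusion inserts, after the variable [n], a word that contains an answer of [T]
    whatever values the variables up to [n] receive. The invariant [I] says that [R] is a mere shift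
    from position [R.2 n] on, which leaves room for the insertion. *)
Lemma residual_cone b u D : word b u -> residual b u D ->
  exists2 R, rigid b R & forall x, bounded b x -> D (subst b x \o R.1).
Proof.
move=> uw [T Ts TD].
pose I n (R : surj) := (forall i, R.1 (R.2 n + i) = b + n + i /\
    R.2 (n + i) = R.2 n + i)%N /\
  forall x, bounded b x -> extends (subst b x \o R.1) u.
pose Phi n (R : surj) := forall x, bounded b x ->
  extends (subst b x \o R.1) u /\
  exists2 m, (n <= m)%N & let y := subst b x \o R.1 in
    extends y (mkseq y m ++ T (mkseq y m)).
have [||n R Rr [Rfree Ru]|n R Q Rr Qr Qn RPhi|R [Rr RPhi]] :=
    @fusion b I Phi (insert b 0 u).
- exact: rigid_insert.
- split=> [i|x xb].
    by rewrite /insert /= !add0n addn0 ifF; lia.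
  apply/extendsP => i iu; rewrite /= add0n iu subn0 /subst.
  by rewrite (all_nthP 0 uw).
(* One word [z] serves all the finitely many prefixes of length [R.2 n + 1]. *)
- have [v|z zw zL] := @strategy_words b T (words b (R.2 n).+1) Ts.
    by rewrite mem_words => /andP[].
  have Qr : rigid b (insert b n.+1 z) by exact: rigid_insert.
  have QE x : subst b x \o (scomp b (insert b n.+1 z) R).1 =
      subst b (subst b x \o (insert b n.+1 z).1) \o R.1.
    by apply/funext => y /=; rewrite subst_comp.
  have Qu x : bounded b x ->
      extends (subst b x \o (scomp b (insert b n.+1 z) R).1) u.
    by move=> xb; rewrite QE; apply: Ru; exact: (bounded_subst _ xb).
  exists (insert b n.+1 z); split.
  + exact: Qr.
  + by move=> i i_n; rewrite /insert /= ltnS i_n.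
  + split=> // i; rewrite /insert /= ltnn.
    have [_ R1] := Rfree (1 + size z)%N.
    have [R3 R2] := Rfree (1 + size z + i)%N.
    rewrite ltnNge leq_addr /=.
    have -> : (n.+1 + size z = n + (1 + size z))%N by lia.
    have -> : (n.+1 + i + size z = n + (1 + size z + i))%N by lia.
    rewrite R1 R2; split; last by lia.
    have -> : (R.2 n + (1 + size z) + i = R.2 n + (1 + size z + i))%N by lia.
    rewrite R3 -addnA subst_ge /= ifF; last by lia.
    rewrite ifF; lia.
  + move=> x xb; split; first exact: Qu.
    set y := _ \o _.
    have yb : bounded b y by exact: (bounded_subst _ xb).
    pose v := mkseq y (R.2 n).+1.
    have yvz : extends y (v ++ z).
      apply/extendsP => i; rewrite size_cat size_mkseq nth_cat size_mkseq.
      case: (ltnP i (R.2 n).+1) => [iv _|vi ivz]; first by rewrite nth_mkseq.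
      have [Ri _] := Rfree (i - R.2 n)%N.
      rewrite subnKC in Ri; last by lia.
      rewrite /y /= Ri -addnA subst_ge /= ifF; last by lia.
      rewrite ifT; last by lia.
      have -> : (n + (i - R.2 n) - n.+1 = i - (R.2 n).+1)%N by lia.
      rewrite /subst ifT //; apply: (all_nthP 0 zw); lia.
    have [|z1 [z2 ez]] := zL v.
      by rewrite mem_words size_mkseq eqxx andbT; exact: word_mkseq.
    move: yvz; rewrite ez !catA => /extends_catl yv.
    have ve : mkseq y (size (v ++ z1)) = v ++ z1 := extends_catl yv.
    exists (size (v ++ z1)); last by cbv zeta; rewrite ve.
    rewrite size_cat size_mkseq; have := rigid_ge n Rr; lia.
- move=> x xb; have := RPhi _ (bounded_subst Q xb).
  suff -> : subst b x \o (scomp b Q R).1 =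
      subst b (subst b x \o Q.1) \o R.1 by [].
  by apply/funext => y /=; rewrite subst_comp.
exists R => // x xb; apply: TD; first exact: (bounded_subst _ xb).
  by have [] := RPhi 0 x xb.
by move=> N; have [_] := RPhi N x xb.
Qed.

(** * Homogeneous cones *)

(** No value is recoded: [a] is both the element [0] over [a] letters and the new letter for [y],
    and [a.+1 + x] equals [a + x.+1]. *)
Definition glue (a : nat) (w : seq nat) (y : point) : point :=
  (fun i => if (i < size w)%N then nth 0 w i
            else if i == size w then a else y.1 (i - (size w).+1)%N,
   size w :: map (addn (size w).+1) y.2).

Lemma inF_glue a K w y : word a.+1 w -> inF a.+1 K y -> inF a K.+1 (glue a w y).
Proof.
move=> ww [sy yb yc]; have wle i : (i < size w)%N -> (nth 0 w i <= a)%N.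
  by move=> iw; rewrite -ltnS; exact: (all_nthP 0 ww).
split=> [|i|x xK] /=; first by rewrite size_map sy.
  case: (ltnP i (size w)) => [/wle|_]; first by lia.
  by case: eqP; [lia|have := yb (i - (size w).+1)%N; lia].
case: x xK => [_|x xK] /=.
  rewrite ltnn eqxx addn0; split=> // i; rewrite leq_eqVlt.
  by case: eqP => [-> _|_ /= iw]; [rewrite ltnn|rewrite iw wle].
rewrite (nth_map 0) ?sy //; have [y1 y2] := yc x xK.
rewrite ifF; last by lia.
rewrite ifF; last by lia.
rewrite addKn y1; split=> [|i ile]; first by rewrite addSnnS.
case: (ltnP i (size w)) => [/wle|iw]; first by lia.
case: eqP => [|ni]; first by lia.
by rewrite -addSnnS; apply: y2; lia.
Qed.

Lemma inF_unglue a K e : inF a K.+1 e ->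
  exists w y, [/\ word a.+1 w, inF a.+1 K y & e = glue a w y].
Proof.
case: e => r [|j js] [] //= [sjs] rb rc.
have [rj rjle] := rc 0 (ltn0Sn K); rewrite /= addn0 in rj rjle.
have jlt x : (x < K)%N -> (j < nth 0 js x)%N.
  move=> xK; rewrite ltnNge; apply/negP => /rjle.
  by have [/= -> _] := rc x.+1 xK; lia.
exists (mkseq r j), (fun i => r (j.+1 + i), [seq i - j.+1 | i <- js])%N; split.
- apply/allP => u /mapP [i]; rewrite mem_iota /= => ij ->.
  by rewrite ltnS rjle // ltnW.
- split=> [|i|x xK] /=; first by rewrite size_map.
    by have := rb (j.+1 + i)%N; lia.
  rewrite (nth_map 0) ?sjs // subnKC; last exact: jlt.
  have [/= -> rle] := rc x.+1 xK; split; first by lia.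
  move=> y yle; rewrite [(a.+1 + x)%N]addSnnS; apply: rle.
  by have := jlt x xK; lia.
- congr pair.
    apply/funext => i /=; rewrite size_mkseq.
    case: ltnP => [ij|]; first by rewrite nth_mkseq.
    by rewrite leq_eqVlt eq_sym; case: eqP => [-> //|_ /= ji]; rewrite subnKC.
  rewrite /= size_mkseq -map_comp; congr cons.
  apply: (@eq_from_nth _ 0) => [|x xK]; first by rewrite size_map.
  by rewrite (nth_map 0) //= subnKC // jlt // -ltnS -sjs.
Qed.

(* The letter [a] of [Q] becomes the variable [n], which takes the value [a] in
   [glue a w y] when [size w = n]. *)
Definition lift (a n : nat) (Q : surj) : surj :=
  (fun i => if (i <= n)%N then (a + i)%N
            else let v := Q.1 (i - n.+1)%N in
                 if (v < a)%N then v else (v + n)%N,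
   fun x => if (x <= n)%N then x else (n.+1 + Q.2 (x - n.+1))%N).

Lemma rigid_lift a n Q : rigid a.+1 Q -> rigid a (lift a n Q).
Proof.
move=> Qr x; rewrite /lift /=; case: (leqP x n) => xn.
  rewrite xn; split=> // i ix; rewrite ifT; lia.
have [Q1 Q2] := Qr (x - n.+1)%N.
rewrite ifF; last by lia.
rewrite addKn Q1 ifF; last by lia.
split=> [|i ix]; first by lia.
case: (leqP i n) => ni; first by lia.
have /Q2 : (i - n.+1 <= Q.2 (x - n.+1))%N by lia.
by case: ifP; lia.
Qed.

Lemma fixes_lift a n Q : fixes a n (lift a n Q).
Proof. by move=> i i_n; rewrite /lift /= i_n. Qed.

(** A refinement [Q] of the tail is induced by a surjection of the whole that depends on [w] only
    through its length and fixes everything up to [size w]. *)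
Lemma act_lift a w y Q : rigid a.+1 Q ->
  act a (glue a w y) (lift a (size w) Q) = glue a w (act a.+1 y Q).
Proof.
move=> Qr; congr pair.
  apply/funext => i; rewrite /lift /=; case: (ltngtP i (size w)) => iw.
  - by rewrite subst_ge iw.
  - case: ltnP => va; first by rewrite /subst va ltnW.
    rewrite /subst (ltnNge _ a) (leq_trans va) ?leq_addr //=.
    rewrite -addnBAC //; set v := Q.1 _ in va *.
    rewrite ifF; last by lia.
    case: (ltnP v a.+1) => va'.
      have -> : v = a by lia.
      by rewrite subnn add0n eqxx.
    rewrite ifF; last by lia.
    by congr (y.1 _); lia.
  - by rewrite subst_ge iw ltnn eqxx.
rewrite /= leqnn -!map_comp; congr cons.
apply: eq_map => t; rewrite /lift /= ifF; last by lia.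
by rewrite addKn.
Qed.

Definition continuous_param (b : nat) (f : (nat -> nat) -> point) :=
  forall x, bounded b x -> forall n, exists m, forall x', bounded b x' ->
    (forall i, (i < m)%N -> x' i = x i) ->
    (f x').2 = (f x).2 /\ forall i, (i < n)%N -> (f x').1 i = (f x).1 i.

(* Unlike the Baire property itself, the Baire property of the preimages under
   all continuous parametrizations passes to continuous preimages. *)
Definition good (a K : nat) (D : set point) := forall b f,
  (forall x, bounded b x -> inF a K (f x)) -> continuous_param b f ->
  baire b (D \o f).

Lemma good_act_glue a K w R D : rigid a R -> word a.+1 w ->
  good a K.+1 D -> good a.+1 K (fun y => D (act a (glue a w y) R)).
Proof.
move=> Rr ww Dg b f fF fc.
apply: (Dg b (fun x => act a (glue a w (f x)) R)) => [x xb|x xb n].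
  by apply: inF_act => //; apply: inF_glue => //; exact: fF.
(* The first [n] values of the product depend only on the values of [f x] below this maximum. *)
have [m fm] := fc x xb (\max_(i < n) (R.1 i).+1).
exists m => x' x'b x'x; have [f2 f1] := fm x' x'b x'x.
rewrite /= f2; split=> // i i_n; rewrite /subst; case: ltnP => // _.
case: ltnP => // _; case: eqP => // _; apply: f1.
have := leq_bigmax (F := fun i : 'I_n => (R.1 i).+1) (Ordinal i_n).
by rewrite /=; lia.
Qed.

Lemma homogeneous_cone0 a l (C : nat -> set point) : (0 < l)%N ->
  (forall k, (k < l)%N -> good a 0 (C k)) ->
  (forall e, inF a 0 e -> exists2 k, (k < l)%N & C k e) ->
  exists R, exists2 k, (k < l)%N & rigid a R /\
    forall e, inF a 0 e -> C k (act a e R).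
Proof.
move=> l0 Cg Ccov.
pose emb (x : nat -> nat) : point := (x, [::]).
have embF x : bounded a x -> inF a 0 (emb x).
  by move=> xa; split=> // i; rewrite addn0.
have FE e : inF a 0 e -> bounded a e.1 /\ e = emb e.1.
  case: e => r [|j js] [] //= _ rb _; split=> // i.
  by have := rb i; rewrite addn0.
have Cb k : (k < l)%N -> baire a (C k \o emb).
  by move=> /Cg; apply=> // x xa n; exists n.
have [[k [u [kl uw Cu]]]|nC] := pselect (exists k u, [/\ (k < l)%N, word a u &
    residual a u (C k \o emb)]).
  have [R Rr RC] := residual_cone uw Cu.
  by exists R, k => //; split=> // e /FE [eb ->]; exact: RC.
(* Over the empty alphabet there are no points, so any surjection and the colour [0] serve. *)
case: (posnP a) => [a0|a0].
  exists (sid a), 0 => //; split; first exact: rigid_sid.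
  by move=> e [_ /(_ 0)]; rewrite a0.
(* If no colour class is comeager in a basic open set, the points without colour form a comeager
   set, which then contains a cone; any element of the cone contradicts the covering. *)
have : residual a [::] (\bigcap_k [set x | (k < l)%N -> ~ C k (emb x)]).
  apply: residual_bigcap => // k v vw.
  case: (ltnP k l) => [kl|_]; last first.
    by exists [::] => //; exists (fun=> [::]).
  have [z zw [Cz|Cz]] := Cb k kl v vw.
    by case: nC; exists k, (v ++ z); split=> //; exact/word_cat.
  by exists z => //; apply: residual_sub Cz => x nCx _.
move=> /residual_cone [//|R Rr RC].
pose x (i : nat) := 0.
have xb : bounded a (subst a x \o R.1) by exact: (@bounded_subst a x).
have [k kl] := Ccov _ (embF _ xb).
by have /(_ k I kl) := RC x (fun=> a0).
Qed.

Lemma homogeneous_cone K : forall a l (C : nat -> set point), (0 < l)%N ->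
  (forall k, (k < l)%N -> good a K (C k)) ->
  (forall e, inF a K e -> exists2 k, (k < l)%N & C k e) ->
  exists R, exists2 k, (k < l)%N & rigid a R /\
    forall e, inF a K e -> C k (act a e R).
Proof.
elim: K => [|K IH] a l C l0 Cg Ccov; first exact: homogeneous_cone0.
(* Past the word [w], the colour does not depend on the tail. *)
pose hom w R := exists2 k, (k < l)%N & forall y, inF a.+1 K y ->
  C k (act a (glue a w y) R).
(* Multiplying by a [Q] that fixes everything up to [size w] keeps [w] and the position [c(0)] and
   changes only the tail. *)
have hom_scomp w R Q : rigid a Q -> fixes a (size w) Q -> word a.+1 w ->
    hom w R -> hom w (scomp a Q R).
  move=> Qr Qw ww [k kl Ck]; exists k => // y yF; rewrite act_scomp.
  have gF := inF_act (inF_glue ww yF) Qr.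
  have [w' [y' [w'w y'F def_e]]] := inF_unglue gF.
  suff -> : act a (glue a w y) Q = glue a w y' by exact: Ck.
  have sw : size w' = size w.
    have [_ Qs] := Qw _ (leqnn _).
    by move: (congr1 (fun e : point => head 0 e.2) def_e); rewrite /= Qs.
  rewrite def_e; congr glue.
  apply: (@eq_from_nth _ 0) => // i; rewrite sw => iw.
  have : (act a (glue a w y) Q).1 i = (glue a w' y').1 i by rewrite def_e.
  by rewrite /= (Qw i (ltnW iw)).1 subst_ge sw iw.
(* The words of length [n] are treated one after another; each refinement preserves what was
   obtained for the earlier ones. *)
have step n (L : seq (seq nat)) R : rigid a R ->
    (forall w, w \in L -> word a.+1 w /\ size w = n) ->
    exists Q, [/\ rigid a Q, fixes a n Q &
      forall w, w \in L -> hom w (scomp a Q R)].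
  move=> Rr; elim: L => [|w L IHL] Lw.
    by exists (sid a); split=> //; exact: rigid_sid.
  have [v vL|Q [Qr Qn QL]] := IHL; first by apply: Lw; rewrite inE vL orbT.
  have [ww sw] := Lw w (mem_head _ _).
  have QRr := rigid_scomp Qr Rr.
  have [k kl|e eF|P [k kl [Pr Pk]]] := IH a.+1 l
      (fun k y => C k (act a (glue a w y) (scomp a Q R))) l0.
  - by apply: good_act_glue => //; exact: Cg.
  - by apply: Ccov; apply: inF_act => //; exact: inF_glue.
  have lr := rigid_lift n Pr.
  exists (scomp a (lift a n P) Q); split.
  - exact: rigid_scomp.
  - by apply: fixes_scomp => //; exact: fixes_lift.
  move=> v; rewrite inE scompA => /orP[/eqP ->|vL].
    by exists k => // y yF; rewrite act_scomp -sw act_lift //; exact: Pk.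
  have [vw sv] : word a.+1 v /\ size v = n by apply: Lw; rewrite inE vL orbT.
  by apply: hom_scomp; rewrite ?sv //; [exact: fixes_lift|exact: QL].
pose Phi n R := forall w, word a.+1 w -> size w = n -> hom w R.
have [||n R Rr _|n R Q Rr Qr Qn RPhi w ww sw|R [Rr RPhi]] :=
    @fusion a (fun _ _ => True) Phi (sid a).
- exact: rigid_sid.
- by [].
- have [w|Q [Qr Qn QL]] := @step n (words a.+1 n) R Rr.
    by rewrite mem_words => /andP[ww /eqP].
  exists Q; split=> // w ww sw; apply: QL.
  by rewrite mem_words sw eqxx andbT.
- by apply: hom_scomp => //; [rewrite sw|exact: RPhi].
have colour w : exists k, word a.+1 w -> (k < l)%N /\
    forall y, inF a.+1 K y -> C k (act a (glue a w y) R).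
  have [ww|nw] := pselect (word a.+1 w); last by exists 0.
  by have [k kl Ck] := RPhi _ w ww erefl; exists k.
have [f fP] := choice colour.
have [w ww|P [k kl [Pr Pk]]] := @word_pigeonhole a l f.
  by have [] := fP w ww.
exists (scomp a P R), k => //; split; first exact: rigid_scomp.
move=> e eF; rewrite act_scomp.
have [w [y [ww yF def_e]]] := inF_unglue eF.
have [w' [y' [w'w y'F def_e']]] := inF_unglue (inF_act eF Pr).
rewrite def_e' -(Pk w ww).
suff <- : w' = mkseq (subst a (nth a w) \o P.1) (P.2 (size w)).
  by have [_] := fP w' w'w; apply.
have sw' : size w' = P.2 (size w).
  by move: (congr1 (fun e : point => head 0 e.2) def_e'); rewrite def_e.
apply: (@eq_from_nth _ 0); rewrite ?size_mkseq // => i iw'.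
rewrite nth_mkseq -?sw' //.
have : (act a e P).1 i = (glue a w' y').1 i by rewrite def_e'.
rewrite /= iw' def_e => <-; rewrite /subst /=; case: ltnP => // ai.
(* Before the new [c(0)] only letters and variables of index at most [size w] occur; the variable
   [size w] takes the value [a], the default in [nth a w]. *)
have : (P.1 i <= a + size w)%N by apply: (Pr _).2; rewrite -sw' ltnW.
case: ltnP => [iw|wi] Pi; first by rewrite (set_nth_default a).
have -> : (P.1 i - a = size w)%N by lia.
by rewrite eqxx nth_default.
Qed.

(** * Coding *)

(** The sets that contain all functions agreeing with [f] on some finite list form a filter; its
    convergence to [f] is tested one coordinate at a time, the product topology being a supremum. *)
Lemma ptws_discrete_nbhs (I : eqType) (T : choiceType)
    (f : {ptws I -> discrete_topology T})
    (P : set {ptws I -> discrete_topology T}) :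
  nbhs f P -> exists s : seq I, forall g : I -> T, {in s, g =1 f} -> P g.
Proof.
pose F : set_system {ptws I -> discrete_topology T} :=
  [set Q | exists s : seq I, forall g : I -> T, {in s, g =1 f} -> Q g].
have FF : Filter F.
  split.
  - by exists [::].
  - move=> Q R [s Qs] [t Rt]; exists (s ++ t) => g gst; split.
      by apply: Qs => i si; apply: gst; rewrite mem_cat si.
    by apply: Rt => i ti; apply: gst; rewrite mem_cat ti orbT.
  - by move=> Q R QR [s Qs]; exists s => g /Qs/QR.
suff : F --> f by exact.
apply/cvg_sup => i U [V [[W oW <-] Wf VU]].
exists [:: i] => g gi; apply: VU; rewrite /= /proj gi ?mem_head //.
Qed.

Section Coding.
Context {d : Order.disp_t} {A : finOrderType d} {K : nat}.

Definition letter_code (T : Type) (phi : T -> nat) (u : A + T) : nat :=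
  match u with inl x => enum_rank x | inr t => #|A| + phi t end.

Lemma letter_code_inj (T : Type) (phi : T -> nat) :
  injective phi -> injective (letter_code phi).
Proof.
move=> phi_inj [x|t] [x'|t'] /=.
- by move/val_inj/enum_rank_inj => ->.
- by move=> e; have := ltn_ord (enum_rank x); rewrite e ltnNge leq_addr.
- by move=> e; have := ltn_ord (enum_rank x'); rewrite -e ltnNge leq_addr.
- by move/addnI/phi_inj => ->.
Qed.

Lemma letter_code_inl (T : Type) (phi : T -> nat) v :
  (v < #|A|)%N -> exists x, letter_code phi (inl x) = v.
Proof. by move=> vA; exists (enum_val (Ordinal vA)); rewrite /= enum_valK. Qed.

Definition code (z : F A nat 'I_K) : point :=
  (fun y => letter_code (@nat_of_ord K) ((set_val z).1 (inr y)),
   [seq (set_val z).2 i | i <- enum 'I_K]).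

Lemma nth_code z (x : 'I_K) : nth 0 (code z).2 x = (set_val z).2 x.
Proof.
by rewrite /= (nth_map x) ?size_enum_ord // nth_ord_enum.
Qed.

Lemma code_inF z : inF #|A| K (code z).
Proof.
have [_ _ zc zle] := set_valP z.
split=> [|y|x xK]; first by rewrite size_map size_enum_ord.
  rewrite /=; case: ((set_val z).1 _) => [t|t] /=; last by rewrite ltn_add2l.
  exact: ltn_addr.
rewrite (nth_code z (Ordinal xK)) /= zc; split=> // y /zle.
case: ((set_val z).1 _) => [t _|t] /=; first by rewrite ltnW // ltn_addr.
by rewrite leEord /= leq_add2l.
Qed.

Lemma code_inj : injective code.
Proof.
move=> z z' [r_eq /(@eq_in_map _ _) c_eq]; apply: val_inj.
have [zA _ _ _] := set_valP z; have [z'A _ _ _] := set_valP z'.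
rewrite [LHS]surjective_pairing [RHS]surjective_pairing.
congr pair; apply/funext; last first.
  by move=> i; apply: c_eq; rewrite mem_enum.
move=> [x|y]; first by rewrite zA z'A.
have /letter_code_inj := congr1 (@^~ y) r_eq; apply; exact: val_inj.
Qed.

Lemma code_surj e : inF #|A| K e -> exists z, code z = e.
Proof.
case: e => r js [/= sjs rb rc].
have /choice [g gP] y : exists u, letter_code (@nat_of_ord K) u = r y.
  case: (ltnP (r y) #|A|) => [/(letter_code_inl (@nat_of_ord K)) [x ex]|ry].
    by exists (inl x).
  have vK : (r y - #|A| < K)%N by rewrite ltn_subLR //; exact: rb.
  by exists (inr (Ordinal vK)); rewrite /= subnKC.
pose z : ambient A nat 'I_K :=
  ((fun u => match u with inl x => inl x | inr y => g y end),
   (fun i : 'I_K => nth 0 js i)).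
have zF : F A nat 'I_K z.
  split=> //= [x y xy|x|x y yx].
  - rewrite ltEnat /= ltnNge; apply/negP => /(rc x (ltn_ord x)).2.
    rewrite (rc y (ltn_ord y)).1; move: xy; rewrite ltEord; lia.
  - apply: (letter_code_inj val_inj); rewrite gP /=.
    exact: (rc x (ltn_ord x)).1.
  - have := (rc x (ltn_ord x)).2 y yx; rewrite -gP.
    by case: (g y) => [//|t] /=; rewrite leq_add2l.
exists (exist _ z (mem_set zF)); congr pair; first exact/funext.
apply: (@eq_from_nth _ 0) => [|i]; rewrite size_map size_enum_ord // => iK.
by rewrite (nth_map (Ordinal iK)) ?size_enum_ord //= nth_enum_ord.
Qed.

Lemma open_code (O : set (F A nat 'I_K)) z : open O -> O z ->
  exists n, forall z', (code z').2 = (code z).2 ->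
    (forall y, (y < n)%N -> (code z').1 y = (code z).1 y) -> O z'.
Proof.
move=> [W oW <-] Wz.
have : nbhs (set_val z) W by apply: open_nbhs_nbhs; split.
move=> [[P Q] /= [/ptws_discrete_nbhs [s Ps] /ptws_discrete_nbhs [t Qt]] PQW].
(* Letters impose no bound: [r] is the identity there for every element of [F]. *)
pose top (u : A + nat) := if u is inr y then y.+1 else 0.
exists (\max_(u <- s) top u) => z' /(@eq_in_map _ _) c_eq r_eq.
have [zA _ _ _] := set_valP z; have [z'A _ _ _] := set_valP z'.
apply: PQW; split; [apply: Ps => -[x|y] us|apply: Qt => i _].
- by rewrite zA z'A.
- apply: (letter_code_inj val_inj); apply: r_eq.
  exact: (leq_bigmax_seq (P := xpredT) (F := top) _ us isT).
- by apply: c_eq; rewrite mem_enum.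
Qed.

(** The sets whose image is good form a sigma-algebra that contains the open sets. *)
Lemma good_Borel C : Borel C -> good #|A| K (code @` C).
Proof.
apply: (@smallest_sub _ _ _ [set C | good #|A| K (code @` C)]).
  split.
  - move=> b f fF fc; apply: baire_open => x xb [z []].
  (* The image of the complement is the complement of the image only among codes, so the two are
     compared along [f], whose values are codes. *)
  - move=> B Bg b f fF fc; apply: baire_ext (baireC (Bg b f fF fc)) => x xb /=.
    have [z zx] := code_surj (fF x xb); rewrite -zx; split.
      by move=> nB; exists z => //; split=> // Bz; apply: nB; exists z.
    move=> [z' [_ nB] /code_inj <-] [z'' Bz'' /code_inj ez].
    by apply: nB; rewrite -ez.
  - move=> B Bg b f fF fc; rewrite image_bigcup /comp.
    exact: (baire_bigcup (fun n => Bg n b f fF fc)).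
move=> O oO b f fF fc; apply: baire_open => x xb [z Oz zx].
have [n On] := open_code oO Oz; have [m fm] := fc x xb n.
exists m => x' x'b x'x; have [z' z'x'] := code_surj (fF x' x'b).
exists z' => //; have [f2 f1] := fm x' x'b x'x.
by apply: On => [|y yn]; rewrite z'x' zx // f1.
Qed.

End Coding.

(** Coding turns composition into [act], so a coded cone comes from an actual one. *)
Lemma realize_rigid d (A : finOrderType d) (R : surj) : rigid #|A| R ->
  exists rc : F A nat nat, forall K (sj : F A nat 'I_K),
    code (F_comp sj rc) = act #|A| (code sj) R.
Proof.
move=> Rr.
have /choice [g gP] y : exists u : A + nat, letter_code id u = R.1 y.
  case: (ltnP (R.1 y) #|A|) => [/(letter_code_inl id) [x ex]|ry].
    by exists (inl x).
  by exists (inr (R.1 y - #|A|)%N); rewrite /= subnKC.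
pose rc : ambient A nat nat :=
  ((fun u => match u with inl x => inl x | inr y => g y end), R.2).
have rcF : F A nat nat rc.
  split=> //= [x y|x|x y yx].
  - exact: rigid_mono Rr.
  - by apply: (letter_code_inj (phi := id)) => //; rewrite gP /= (Rr x).1.
  - have := (Rr x).2 y yx; rewrite -gP.
    by case: (g y) => [//|t] /=; rewrite leq_add2l.
exists (exist _ rc (mem_set rcF)) => K sj.
have [sA _ _ _] := set_valP sj.
congr pair; last by rewrite -[RHS](map_comp R.2).
apply/funext => y; rewrite /= -gP; case: (g y) => [x|t] /=.
  by rewrite sA /subst /= ltn_ord.
by rewrite subst_ge.
Qed.

Theorem theorem3 (d : Order.disp_t) (A : finOrderType d) (K l : nat)
    (l_gt0 : (0 < l)%N) (C : 'I_l -> set (F A nat 'I_K))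
    (C_Borel : forall m : 'I_l, Borel (C m))
    (C_cover : [set: F A nat 'I_K] = \bigcup_(m in [set: 'I_l]) C m) :
  exists (rc0 : F A nat nat) (k : 'I_l), cone K rc0 `<=` C k.
Proof.
(* In [homogeneous_cone] colours are indexed by natural numbers; those from [l] on get the empty
   class. *)
pose D k : set point := if insub k is Some m then code @` C m else set0.
have DE (m : 'I_l) : D m = code @` C m by rewrite /D valK.
have [k kl|e eF|R [k kl [Rr RD]]] := @homogeneous_cone K #|A| l D l_gt0.
- by rewrite (DE (Ordinal kl)); exact: good_Borel.
- have [z <-] := code_surj eF; have : [set: F A nat 'I_K] z by [].
  by rewrite C_cover => -[m _ Cz]; exists m => //; rewrite DE; exists z.
have [rc rcE] := realize_rigid Rr.
exists rc, (Ordinal kl) => _ [sj _ <-].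
have := RD _ (code_inF sj); rewrite -rcE (DE (Ordinal kl)).
by move=> [z Cz /code_inj <-].
Qed.
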